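(* Let $(\lambda_n)_{n\ge1}$ be any sequence in $\mathbb C\setminus\{0\}$, and let $\underline a=(a_n)_{n\ge1}$, $\underline b=(b_n)_{n\ge1}$ be sequences with $0<a_n<b_n$ for all $n$. Suppose that $\inf_{n\in\mathbb N} a_n>0$ and \[ \liminf_{n\to\infty}\left(\frac{\Delta_{n+1}}{a_1\cdots a_n}\right)^{1/n}=0, \] where $\Delta_n=\log(b_n/a_n)$. Then $\dim_H I_{\underline a}^{\underline b}(E_{\underline\lambda})\le 1$.
   Context: For $\lambda\in\mathbb C\setminus\{0\}$ let $E_\lambda(z)=\lambda e^z$. For $\underline\lambda=(\lambda_n)_{n\ge1}$ and sequences $\underline a,\underline b$ with $0<a_n<b_n$, \[ I_{\underline a}^{\underline b}(E_{\underline\lambda})=\{z\in\mathbb C:\ a_n\le |E_{\lambda_n}\circ\cdots\circ E_{\lambda_1}(z)|\le b_n \text{ for every sufficiently large } n\in\mathbb N\}. \] $\dim_H$ denotes Hausdorff dimension. *)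

(* Defs.v *)
From Stdlib Require Import Reals.
From Coquelicot Require Import Coquelicot.
Open Scope R_scope.

Definition cexp (z : C) : C := (exp (fst z) * cos (snd z), exp (fst z) * sin (snd z)).

Definition E_lam (lam z : C) : C := Cmult lam (cexp z).

(** Eiter lam n z = E_{lam n} o ... o E_{lam 1} (z); the sequence is indexed
    from 1, lam 0 is never used. *)
Fixpoint Eiter (lam : nat -> C) (n : nat) (z : C) : C :=
  match n with
  | O => z
  | S m => E_lam (lam (S m)) (Eiter lam m z)
  end.

Definition I_set (lam : nat -> C) (a b : nat -> R) (z : C) : Prop :=
  exists N : nat, forall n : nat, (1 <= n)%nat -> (N <= n)%nat ->
    a n <= Cmod (Eiter lam n z) <= b n.

Fixpoint prod_a (a : nat -> R) (n : nat) : R :=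
  match n with
  | O => 1
  | S m => prod_a a m * a (S m)
  end.

Definition Delta_n (a b : nat -> R) (n : nat) : R := ln (b n / a n).

(** diameter of a set, as an extended real (m_infty for the empty set) *)
Definition diam (U : C -> Prop) : Rbar :=
  Lub_Rbar (fun r => exists x y, U x /\ U y /\ r = Cmod (Cminus x y)).

Definition pw (d s : R) : R :=
  if Rlt_dec 0 d then Rpower d s else if Req_EM_T s 0 then 1 else 0.

(** contribution diam(U)^s of a cover element (empty sets contribute 0) *)
Definition cost (s : R) (U : C -> Prop) : R :=
  match diam U with
  | Finite d => pw d s
  | _ => 0
  end.

Fixpoint psum (f : nat -> R) (N : nat) : R :=
  match N with
  | O => 0
  | S m => psum f m + f m
  end.

(** sum_{i>=0} f i of a nonnegative series, in [0, +oo] *)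
Definition series_sum (f : nat -> R) : Rbar :=
  Lub_Rbar (fun x => exists N, x = psum f N).

Definition Hs_delta (s delta : R) (A : C -> Prop) : Rbar :=
  Rbar_glb (fun v => exists U : nat -> (C -> Prop),
     (forall i, Rbar_le (diam (U i)) (Finite delta)) /\
     (forall z, A z -> exists i, U i z) /\
     v = series_sum (fun i => cost s (U i))).

Definition Hmeas (s : R) (A : C -> Prop) : Rbar :=
  Rbar_lub (fun v => exists delta, 0 < delta /\ v = Hs_delta s delta A).

Definition dimH (A : C -> Prop) : Rbar :=
  Rbar_glb (fun t => exists s, 0 <= s /\ t = Finite s /\ Hmeas s A = Finite 0).

(* Main.v *)
Require Import Defs.
From Stdlib Require Import Reals Lra Lia List Arith Cantor FinFun.
From Stdlib Require Import Classical ClassicalEpsilon.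
From Coquelicot Require Import Coquelicot.
Open Scope R_scope.

(** Fix [s > 1] and write [Z_n] for the [n]-th iterate. A piece of diameter [d] at
    distance at least [rho >= 2 d] from [0] pulls back under [E_lam] to translates by
    [2 pi i Z] of sets of diameter [O(d / rho)]. At the points [w] of modulus between [r]
    and [2 r] only [O(r)] translates matter, and weighting each by [|w|^(-s)] and summing
    over dyadic [r >= a_n] gives [O(a_n^(1-s))]. Hence [n] successive pullbacks multiply
    the [s]-cost of a piece by at most [K^n (a_1 ... a_(n-1))^(1-s)]. Since
    [|Z_(n+1)| = |lam_(n+1)| exp (Re Z_n)], the constraint at time [n+1] puts [Z_n] in a
    vertical strip of width [Delta_(n+1)], whose part outside the disc of radius [a_n] has
    weighted cost [O((Delta_(n+1) / a_n)^(s-1))]. The total cost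
    [O(K^n (Delta_(n+1) / (a_1 ... a_n))^(s-1))] is arbitrarily small along the
    subsequence given by the liminf condition, because the geometric factor [K^n] is
    harmless there. *)

(** * Countable covers with controlled cost *)

Lemma psum_nonneg (f : nat -> R) (N : nat) : (forall i, 0 <= f i) -> 0 <= psum f N.
Proof. intros H; induction N as [|N IH]; simpl; [lra|specialize (H N); lra]. Qed.

Lemma psum_le (f g : nat -> R) (N : nat) :
  (forall i, f i <= g i) -> psum f N <= psum g N.
Proof. intros H; induction N as [|N IH]; simpl; [lra|specialize (H N); lra]. Qed.

Lemma psum_ge_term (f : nat -> R) (i : nat) :
  (forall i, 0 <= f i) -> f i <= psum f (S i).
Proof. intros H; simpl; pose proof (psum_nonneg f i H); lra. Qed.

Lemma psum_scal (f : nat -> R) (k : R) (N : nat) :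
  psum (fun i => k * f i) N = k * psum f N.
Proof. induction N as [|N IH]; simpl; [ring|rewrite IH; ring]. Qed.

Lemma psum_geom_le (q : R) (N : nat) :
  0 <= q < 1 -> psum (fun i => q ^ i) N <= / (1 - q).
Proof.
  intros Hq.
  assert (E : psum (fun i => q ^ i) N = (1 - q ^ N) * / (1 - q)).
  { induction N as [|N IH]; simpl; [ring|rewrite IH; field; lra]. }
  rewrite E.
  assert (0 <= q ^ N) by (apply pow_le; lra).
  assert (0 < / (1 - q)) by (apply Rinv_0_lt_compat; lra).
  nra.
Qed.

Definition lsum {X : Type} (f : X -> R) (l : list X) : R :=
  fold_right (fun x acc => f x + acc) 0 l.

Lemma lsum_nonneg {X : Type} (f : X -> R) (l : list X) :
  (forall x, 0 <= f x) -> 0 <= lsum f l.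
Proof. intros H; induction l as [|x l IH]; simpl; [lra|specialize (H x); lra]. Qed.

Lemma lsum_app {X : Type} (f : X -> R) (l l' : list X) :
  lsum f (l ++ l') = lsum f l + lsum f l'.
Proof. induction l as [|x l IH]; simpl; [ring|rewrite IH; ring]. Qed.

Lemma lsum_incl {X : Type} (f : X -> R) (l l' : list X) :
  (forall x, 0 <= f x) -> NoDup l -> incl l l' -> lsum f l <= lsum f l'.
Proof.
  intros Hf; revert l'; induction l as [|x l IH]; intros l' Hnd Hin; simpl.
  - now apply lsum_nonneg.
  - inversion Hnd as [|? ? Hx Hl]; subst.
    destruct (in_split x l' (Hin x (or_introl eq_refl))) as [l1 [l2 ->]].
    assert (H : lsum f l <= lsum f (l1 ++ l2)).
    { apply IH; [easy|]. intros y Hy.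
      assert (Hy' := Hin y (or_intror Hy)).
      apply in_app_iff in Hy'; apply in_app_iff.
      destruct Hy' as [Hy'|[Hy'|Hy']]; [now left| |now right].
      subst; contradiction. }
    rewrite lsum_app in *; simpl; lra.
Qed.

Lemma lsum_map_seq (f : nat -> R) (N : nat) : lsum f (seq 0 N) = psum f N.
Proof.
  induction N as [|N IH]; [reflexivity|].
  rewrite seq_S, lsum_app, IH; simpl; ring.
Qed.

Lemma lsum_prod (f : nat -> nat -> R) (l l' : list nat) :
  lsum (fun p => f (fst p) (snd p)) (list_prod l l') = lsum (fun i => lsum (f i) l') l.
Proof.
  induction l as [|i l IH]; [reflexivity|].
  simpl list_prod; rewrite lsum_app, IH; simpl; f_equal.
  clear; induction l' as [|j l' IH]; simpl; [reflexivity|now rewrite IH].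
Qed.

(** The first [N] pairs of the Cantor enumeration are distinct and lie in some square [M] by [M], so
    nonnegativity bounds their sum by the sum over the whole square, which is then taken row by
    row. *)
Lemma psum_cantor_le (f : nat -> nat -> R) (t : nat -> R) (T : R) (N : nat) :
  (forall i j, 0 <= f i j) ->
  (forall i n, psum (f i) n <= t i) -> (forall n, psum t n <= T) ->
  psum (fun n => f (fst (of_nat n)) (snd (of_nat n))) N <= T.
Proof.
  intros Hf Hrow Hcol.
  assert (HM : exists M, forall n, (n < N)%nat ->
    (fst (of_nat n) < M)%nat /\ (snd (of_nat n) < M)%nat).
  { induction N as [|N [M IH]]; [exists 0%nat; lia|].
    exists (M + S (fst (of_nat N)) + S (snd (of_nat N)))%nat; intros n Hn.
    destruct (Nat.eq_dec n N) as [->|Hne]; [lia|].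
    specialize (IH n ltac:(lia)); lia. }
  destruct HM as [M HM].
  apply Rle_trans with
    (lsum (fun p => f (fst p) (snd p)) (list_prod (seq 0 M) (seq 0 M))).
  - apply Rle_trans with
      (lsum (fun p => f (fst p) (snd p)) (map of_nat (seq 0 N))).
    + right; rewrite <- lsum_map_seq.
      generalize (seq 0 N); intros l; induction l as [|x l IH]; simpl;
        [reflexivity|now rewrite IH].
    + apply lsum_incl; [intros; apply Hf| |].
      * apply Injective_map_NoDup; [|apply seq_NoDup].
        intros x y Hxy; rewrite <- (cancel_to_of x), <- (cancel_to_of y), Hxy; reflexivity.
      * intros p Hp; apply in_map_iff in Hp; destruct Hp as [n [<- Hn]].
        apply in_seq in Hn; specialize (HM n ltac:(lia)).
        rewrite (surjective_pairing (of_nat n)).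
        apply in_prod; apply in_seq; lia.
  - rewrite lsum_prod, lsum_map_seq.
    apply Rle_trans with (psum t M); [|apply Hcol].
    apply psum_le; intros i; rewrite lsum_map_seq; apply Hrow.
Qed.

Lemma pw_pos (d s : R) : 0 < d -> pw d s = Rpower d s.
Proof. intros H; unfold pw; destruct (Rlt_dec 0 d); [reflexivity|contradiction]. Qed.

Lemma pw_nonpos (d s : R) : d <= 0 -> 0 < s -> pw d s = 0.
Proof.
  intros H Hs; unfold pw; destruct (Rlt_dec 0 d); [lra|].
  destruct (Req_EM_T s 0); [lra|reflexivity].
Qed.

Lemma Rpower_pos (x y : R) : 0 < Rpower x y.
Proof. apply exp_pos. Qed.

Lemma pw_le_Rpower (x d s : R) : 0 < s -> 0 < d -> x <= d -> pw x s <= Rpower d s.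
Proof.
  intros Hs Hd Hx; destruct (Rlt_dec 0 x) as [H|H].
  - rewrite pw_pos by easy; apply Rle_Rpower_l; lra.
  - rewrite pw_nonpos by lra; apply Rlt_le, Rpower_pos.
Qed.

(* The upper bounds [t i] need not be powers of diameters, so that [t i = 0] can pad a
   finite family with empty sets. *)
Definition covered (s : R) (A : C -> Prop) (T : R) : Prop :=
  exists (U : nat -> C -> Prop) (t : nat -> R),
    (forall i, 0 <= t i) /\
    (forall i x y, U i x -> U i y -> pw (Cmod (Cminus x y)) s <= t i) /\
    (forall z, A z -> exists i, U i z) /\
    (forall N, psum t N <= T).

Lemma covered_mono (s : R) (A B : C -> Prop) (T T' : R) :
  (forall z, A z -> B z) -> T <= T' -> covered s B T -> covered s A T'.
Proof.
  intros HAB HT (U & t & H1 & H2 & H3 & H4); exists U, t; refine (conj _ (conj _ (conj _ _))); auto.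
  intros N; specialize (H4 N); lra.
Qed.

Lemma covered_nonneg (s : R) (A : C -> Prop) (T : R) : covered s A T -> 0 <= T.
Proof. intros (U & t & _ & _ & _ & H); apply (H 0%nat). Qed.

Lemma covered_empty (s : R) (A : C -> Prop) (T : R) :
  (forall z, ~ A z) -> 0 <= T -> covered s A T.
Proof.
  intros HA HT; exists (fun _ _ => False), (fun _ => 0); refine (conj _ (conj _ (conj _ _))).
  - intros; lra.
  - intros; contradiction.
  - intros z Hz; destruct (HA z Hz).
  - intros N; apply Rle_trans with 0; [|easy].
    induction N as [|N IH]; simpl; lra.
Qed.

(** One piece suffices; the remaining members of the sequence are empty with weight 0. A positive
    [d] keeps [Rpower d s] a genuine power, since [Rpower 0 s] evaluates to 1. *)
Lemma covered_diam (s : R) (A : C -> Prop) (d : R) :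
  0 < s -> 0 < d -> (forall x y, A x -> A y -> Cmod (Cminus x y) <= d) ->
  covered s A (Rpower d s).
Proof.
  intros Hs Hd HA; pose proof (Rpower_pos d s) as Hp.
  exists (fun i z => i = 0%nat /\ A z), (fun i => if Nat.eq_dec i 0 then Rpower d s else 0).
  refine (conj _ (conj _ (conj _ _))).
  - intros i; destruct (Nat.eq_dec i 0); lra.
  - intros i x y [-> Hx] [_ Hy]; simpl; apply pw_le_Rpower; auto.
  - intros z Hz; exists 0%nat; auto.
  - intros N; destruct N as [|N]; [simpl; lra|].
    induction N as [|N IH]; [simpl; lra|].
    change (psum (fun i => if Nat.eq_dec i 0 then Rpower d s else 0) (S N) + 0 <= Rpower d s).
    lra.
Qed.

Lemma fun_choice {X Y : Type} (P : X -> Y -> Prop) :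
  (forall x, exists y, P x y) -> exists f, forall x, P x (f x).
Proof.
  intros H.
  exists (fun x => proj1_sig (constructive_indefinite_description (P x) (H x))).
  intros x; exact (proj2_sig (constructive_indefinite_description (P x) (H x))).
Qed.

(** Choice picks one cover for each [A j], and Cantor pairing merges these covers into a single
    sequence. *)
Lemma covered_bigunion (s : R) (A : nat -> C -> Prop) (t : nat -> R) (T : R) :
  (forall j, covered s (A j) (t j)) -> (forall N, psum t N <= T) ->
  covered s (fun z => exists j, A j z) T.
Proof.
  intros HA HT.
  assert (HA' : forall j, exists p : (nat -> C -> Prop) * (nat -> R),
    (forall i, 0 <= snd p i) /\
    (forall i x y, fst p i x -> fst p i y -> pw (Cmod (Cminus x y)) s <= snd p i) /\
    (forall z, A j z -> exists i, fst p i z) /\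
    (forall N, psum (snd p) N <= t j)).
  { intros j; destruct (HA j) as (U & u & H); exists (U, u); exact H. }
  destruct (fun_choice _ HA') as [F HF].
  exists (fun n => fst (F (fst (of_nat n))) (snd (of_nat n))),
         (fun n => snd (F (fst (of_nat n))) (snd (of_nat n))).
  refine (conj _ (conj _ (conj _ _))).
  - intros n; exact (proj1 (HF _) _).
  - intros n; exact (proj1 (proj2 (HF _)) _).
  - intros z [j Hj]; destruct (HF j) as (_ & _ & H & _).
    destruct (H z Hj) as [i Hi]; exists (to_nat (j, i)).
    rewrite cancel_of_to; exact Hi.
  - intros N; apply (psum_cantor_le (fun j i => snd (F j) i) t T).
    + intros j i; apply (HF j).
    + intros j; apply (HF j).
    + exact HT.
Qed.

Lemma covered_union (s : R) (A B : C -> Prop) (T T' : R) :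
  covered s A T -> covered s B T' -> covered s (fun z => A z \/ B z) (T + T').
Proof.
  intros HA HB.
  assert (H0 := covered_nonneg _ _ _ HA); assert (H1 := covered_nonneg _ _ _ HB).
  apply (covered_mono s _ (fun z => exists j : nat,
      match j with O => A z | 1%nat => B z | _ => False end) (T + T')); [|lra|].
  - intros z [H|H]; [exists 0%nat|exists 1%nat]; exact H.
  - apply (covered_bigunion s
      (fun j z => match j with O => A z | 1%nat => B z | _ => False end)
      (fun j => match j with O => T | 1%nat => T' | _ => 0 end)).
    + intros [|[|j]]; [exact HA|exact HB|apply covered_empty; [tauto|lra]].
    + intros [|[|N]]; [simpl; lra|simpl; lra|].
      induction N as [|N IH]; [simpl; lra|].
      change (psum (fun j => match j with O => T | 1%nat => T' | _ => 0 end) (S (S N)) + 0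
        <= T + T'); lra.
Qed.

(** The range of [g] is cut into closed windows of length [h], at most [W / h + 1] of them. Applied
    to real and imaginary parts in turn, this counts squares. *)
Lemma covered_slices (s : R) (A : C -> Prop) (g : C -> R) (x0 W h t : R) :
  0 < h -> 0 <= W ->
  (forall z, A z -> x0 <= g z <= x0 + W) ->
  (forall x, covered s (fun z => A z /\ x <= g z <= x + h) t) ->
  covered s A ((W / h + 1) * t).
Proof.
  intros Hh HW HA Ht.
  assert (Ht0 := covered_nonneg _ _ _ (Ht 0)).
  destruct (nfloor_ex (W / h)) as [N [HN1 HN2]].
  { apply Rdiv_le_0_compat; lra. }
  apply (covered_mono s A A ((INR N + 1) * t)); [easy|nra|].
  assert (HWN : W <= (INR N + 1) * h).
  { replace W with (W / h * h) by (field; lra). nra. }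
  clear HN1 HN2 HW.
  (* The lowest window is peeled off and the induction continues on the rest of [A], so the set, the
     left end and the length must all vary. *)
  revert A x0 W HA HWN Ht; induction N as [|N IH]; intros A x0 W HA HWN Ht.
  - apply (covered_mono s A (fun z => A z /\ x0 <= g z <= x0 + h) t); [|simpl; lra|apply Ht].
    intros z Hz; specialize (HA z Hz); simpl in HWN; split; [easy|lra].
  - rewrite S_INR in *.
    apply (covered_mono s A (fun z => (A z /\ x0 <= g z <= x0 + h) \/
      (A z /\ x0 + h <= g z)) (t + (INR N + 1) * t)); [|lra|].
    + intros z Hz; destruct (Rle_dec (g z) (x0 + h)); [left|right]; split; auto; try lra.
      specialize (HA z Hz); lra.
    + apply covered_union; [apply Ht|].
      apply (IH _ (x0 + h) (W - h)).
      * intros z [Hz1 Hz2]; specialize (HA z Hz1); lra.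
      * lra.
      * intros x; apply (covered_mono s _ (fun z => A z /\ x <= g z <= x + h) t);
          [tauto|lra|apply Ht].
Qed.

(** The annuli with [r = 2 ^ j * a] exhaust the set, and their costs form a geometric series of
    ratio [Rpower 2 (1 - s)]. The ratio is below 1 because [s > 1]. *)
Lemma covered_dyadic (s : R) (A : C -> Prop) (f : C -> C) (a T : R) :
  1 < s -> 0 < a ->
  (forall z, A z -> a <= Cmod (f z)) ->
  (forall r, a <= r ->
     covered s (fun z => A z /\ r <= Cmod (f z) <= 2 * r) (T * Rpower r (1 - s))) ->
  covered s A (/ (1 - Rpower 2 (1 - s)) * (T * Rpower a (1 - s))).
Proof.
  intros Hs Ha HA HT.
  assert (Hpa := Rpower_pos a (1 - s)).
  (* The sign of [T] comes from the covering at [r = a]: its cost is nonnegative and the power of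
     [a] is positive. *)
  assert (HT0 : 0 <= T).
  { assert (H := covered_nonneg _ _ _ (HT a (Rle_refl a))).
    destruct (Rle_dec 0 T); [easy|nra]. }
  assert (Hq : 0 <= Rpower 2 (1 - s) < 1).
  { split; [apply Rlt_le, Rpower_pos|].
    apply Rlt_le_trans with (Rpower 2 0); [apply Rpower_lt; lra|rewrite Rpower_O; lra]. }
  apply (covered_mono s A (fun z => exists j : nat,
    A z /\ 2 ^ j * a <= Cmod (f z) <= 2 * (2 ^ j * a))
    (/ (1 - Rpower 2 (1 - s)) * (T * Rpower a (1 - s)))).
  - intros z Hz; specialize (HA z Hz).
    (* Some [2 ^ N * a] exceeds the modulus; descending from this [N] stops at an annulus containing
       [f z], at the latest at [j = 0]. *)
    destruct (Pow_x_infinity 2 ltac:(rewrite Rabs_pos_eq; lra) (Cmod (f z) / a)) as [N HN].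
    specialize (HN N (Nat.le_refl N)).
    assert (H : Cmod (f z) <= 2 ^ N * a).
    { rewrite Rabs_pos_eq in HN by (apply pow_le; lra).
      replace (Cmod (f z)) with (Cmod (f z) / a * a) by (field; lra).
      apply Rmult_le_compat_r; lra. }
    clear HN; induction N as [|N IH].
    + exists 0%nat; rewrite pow_O in *; split; [easy|lra].
    + destruct (Rle_dec (2 ^ N * a) (Cmod (f z))) as [H'|H'].
      * exists N; split; [easy|rewrite <- tech_pow_Rmult in H; lra].
      * apply IH; lra.
  - lra.
  - apply (covered_bigunion s _
      (fun j => (T * Rpower a (1 - s)) * Rpower 2 (1 - s) ^ j)).
    + intros j.
      assert (Hj : 0 < 2 ^ j) by (apply pow_lt; lra).
      assert (Hj1 : 1 <= 2 ^ j) by (apply pow_R1_Rle; lra).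
      assert (Hr : a <= 2 ^ j * a) by nra.
      refine (covered_mono s _ _ _ _ (fun z Hz => Hz) _ (HT _ Hr)); right.
      rewrite <- Rpower_mult_distr by lra.
      rewrite <- (Rpower_pow j 2) by lra.
      rewrite <- (Rpower_pow j (Rpower 2 (1 - s))) by apply Rpower_pos.
      rewrite !Rpower_mult, (Rmult_comm (INR j)); ring.
    + intros N; rewrite psum_scal.
      assert (H := psum_geom_le (Rpower 2 (1 - s)) N Hq).
      rewrite Rmult_comm; apply Rmult_le_compat_r; [nra|exact H].
Qed.

(** * Distortion of the exponential *)

Lemma fst_le_Cmod (z : C) : Rabs (fst z) <= Cmod z.
Proof. apply Rle_trans with (2 := Rmax_Cmod z), Rmax_l. Qed.

Lemma snd_le_Cmod (z : C) : Rabs (snd z) <= Cmod z.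
Proof. apply Rle_trans with (2 := Rmax_Cmod z), Rmax_r. Qed.

Lemma Cmod_le_abs (z : C) : Cmod z <= Rabs (fst z) + Rabs (snd z).
Proof.
  assert (Hx := Rabs_pos (fst z)); assert (Hy := Rabs_pos (snd z)).
  unfold Cmod; rewrite <- (sqrt_pow2 (Rabs (fst z) + Rabs (snd z))) by lra.
  apply sqrt_le_1_alt.
  rewrite <- (pow2_abs (fst z)), <- (pow2_abs (snd z)); nra.
Qed.

Lemma cexp_plus (u v : C) : cexp (Cplus u v) = Cmult (cexp u) (cexp v).
Proof.
  unfold cexp, Cmult, Cplus; simpl.
  rewrite exp_plus, cos_plus, sin_plus; f_equal; ring.
Qed.

Lemma Cmod_cexp (z : C) : Cmod (cexp z) = exp (fst z).
Proof.
  unfold Cmod, cexp; simpl fst; simpl snd.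
  assert (He := exp_pos (fst z)); assert (H := sin2_cos2 (snd z)); unfold Rsqr in H.
  rewrite <- (sqrt_pow2 (exp (fst z))) by lra; f_equal.
  rewrite (sqrt_pow2 (exp (fst z))) by lra.
  replace ((exp (fst z) * cos (snd z)) ^ 2 + (exp (fst z) * sin (snd z)) ^ 2)
    with (exp (fst z) ^ 2 * (sin (snd z) * sin (snd z) + cos (snd z) * cos (snd z))) by ring.
  rewrite H; ring.
Qed.

Lemma Cmod_E_lam (l z : C) : Cmod (E_lam l z) = Cmod l * exp (fst z).
Proof. unfold E_lam; rewrite Cmod_mult, Cmod_cexp; reflexivity. Qed.

(** Mean value theorem: on [[0, 1]] the cosine is at least [cos (PI / 3)], which is 1/2, because
    [PI > 3]. *)
Lemma sin_ge_half (y : R) : 0 <= y <= 1 -> y / 2 <= sin y.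
Proof.
  intros [Hy0 Hy1].
  destruct (Req_dec y 0) as [->|Hy]; [rewrite sin_0; lra|].
  destruct (MVT_cor2 sin cos 0 y ltac:(lra) (fun c _ => derivable_pt_lim_sin c))
    as [c [Hc1 Hc2]].
  rewrite sin_0 in Hc1.
  assert (HPI := PI2_3_2).
  assert (Hcos : cos (PI / 3) <= cos c) by (apply cos_decr_1; lra).
  rewrite cos_PI3 in Hcos; nra.
Qed.

Lemma abs_le_2_abs_sin (y : R) : Rabs y <= 1 -> Rabs y <= 2 * Rabs (sin y).
Proof.
  intros H; destruct (Rle_dec 0 y) as [Hy|Hy].
  - rewrite Rabs_pos_eq in * by lra.
    assert (Hs := sin_ge_half y ltac:(lra)); rewrite Rabs_pos_eq; lra.
  - rewrite Rabs_left in * by lra.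
    assert (Hs := sin_ge_half (- y) ltac:(lra)); rewrite sin_neg in Hs.
    rewrite Rabs_left1; lra.
Qed.

(** If [cexp u] is near 1, then [u] is near a multiple of 2 pi i, and [Rabs (snd u) <= 1] singles
    out the multiple 0. Since [exp (fst u)] is at least 1/2, the sine is at most [2 * e] and the
    imaginary part at most [4 * e]; adding [2 * e] for the real part gives [6 * e]. *)
Lemma cexp_near_1 (u : C) (e : R) :
  Cmod (Cminus (cexp u) 1) <= e -> e <= / 2 ->
  Rabs (fst u) <= 2 * e /\ (Rabs (snd u) <= 1 -> Cmod u <= 6 * e).
Proof.
  intros He Hle.
  assert (He0 : 0 <= e) by (apply Rle_trans with (2 := He), Cmod_ge_0).
  assert (Hx : Rabs (exp (fst u) - 1) <= e).
  { rewrite <- Cmod_cexp.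
    assert (H1 := Cmod_triangle (Cminus (cexp u) 1) 1).
    assert (H2 := Cmod_triangle (cexp u) (Copp (Cminus (cexp u) 1))).
    rewrite Cmod_opp in H2; rewrite Cmod_1 in H1.
    replace (Cplus (cexp u) (Copp (Cminus (cexp u) 1))) with (RtoC 1) in H2 by ring.
    replace (Cplus (Cminus (cexp u) 1) 1) with (cexp u) in H1 by ring.
    rewrite Cmod_1 in H2; apply Rabs_le; lra. }
  apply Rabs_le_between in Hx.
  assert (H1 := exp_ineq1_le (fst u)); assert (H2 := exp_ineq1_le (- fst u)).
  assert (H3 : exp (fst u) * exp (- fst u) = 1)
    by (rewrite <- exp_plus, Rplus_opp_r; apply exp_0).
  assert (Hex := exp_pos (fst u)).
  assert (Hre : Rabs (fst u) <= 2 * e).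
  { apply Rabs_le; split; [|lra].
    destruct (Rle_dec (- (2 * e)) (fst u)) as [|Hn]; [easy|exfalso].
    (* The factors are lower bounds for [exp (fst u)] and [exp (- fst u)], whose product is 1. If
       [fst u < - (2 * e)], the left side exceeds [(1 - e) * (1 + 2 * e)], which is at least 1 for
       [e <= / 2]. *)
    assert ((1 - e) * (1 - fst u) <= 1) by nra.
    nra. }
  split; [easy|intros Hy].
  assert (Hs : Rabs (exp (fst u) * sin (snd u)) <= e).
  { apply Rle_trans with (2 := He).
    replace (exp (fst u) * sin (snd u)) with (snd (Cminus (cexp u) 1))
      by (simpl; ring).
    apply snd_le_Cmod. }
  rewrite Rabs_mult, (Rabs_pos_eq (exp (fst u))) in Hs by lra.
  assert (Hsin := abs_le_2_abs_sin _ Hy); assert (H0 := Rabs_pos (sin (snd u))).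
  apply Rle_trans with (1 := Cmod_le_abs u).
  assert (Rabs (sin (snd u)) <= 2 * e) by nra.
  lra.
Qed.

(** The difference of the images factors as [E_lam l v2] times [cexp (v1 - v2) - 1]; dividing by the
    modulus of the first factor leaves a bound [d / rho] in which [l] no longer appears. *)
Lemma E_lam_inverse_bound (l v1 v2 : C) (d rho : R) :
  0 < rho -> 2 * d <= rho -> rho <= Cmod (E_lam l v2) ->
  Cmod (Cminus (E_lam l v1) (E_lam l v2)) <= d ->
  Rabs (fst v1 - fst v2) <= 1 /\
  (Rabs (snd v1 - snd v2) <= 1 -> Cmod (Cminus v1 v2) <= 6 * (d / rho)).
Proof.
  intros Hrho Hd Hv2 Hv.
  assert (Hdr : d / rho <= / 2).
  { apply Rmult_le_reg_r with rho; [easy|].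
    unfold Rdiv; rewrite Rmult_assoc, Rinv_l by lra; lra. }
  assert (Hfac : Cminus (E_lam l v1) (E_lam l v2)
      = Cmult (E_lam l v2) (Cminus (cexp (Cminus v1 v2)) 1)).
  { unfold E_lam; replace v1 with (Cplus (Cminus v1 v2) v2) at 1 by ring.
    rewrite cexp_plus; ring. }
  rewrite Hfac, Cmod_mult in Hv.
  assert (H0 := Cmod_ge_0 (Cminus (cexp (Cminus v1 v2)) 1)).
  assert (He : Cmod (Cminus (cexp (Cminus v1 v2)) 1) <= d / rho).
  { apply Rmult_le_reg_r with rho; [easy|].
    unfold Rdiv; rewrite Rmult_assoc, Rinv_l by lra; nra. }
  destruct (cexp_near_1 _ _ He Hdr) as [H1 H2].
  split; [simpl in H1; unfold Rminus; lra|exact H2].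
Qed.

(** * Pulling covers back along orbits *)

Lemma covered_box (s : R) (A : C -> Prop) (f : C -> C) (x0 W y0 H h t : R) :
  0 < h -> 0 <= W -> 0 <= H ->
  (forall z, A z -> x0 <= fst (f z) <= x0 + W) ->
  (forall z, A z -> y0 <= snd (f z) <= y0 + H) ->
  (forall x y, covered s
     (fun z => A z /\ x <= fst (f z) <= x + h /\ y <= snd (f z) <= y + h) t) ->
  covered s A ((W / h + 1) * ((H / h + 1) * t)).
Proof.
  intros Hh HW HH HAx HAy Ht.
  apply (covered_slices s A (fun z => fst (f z)) x0 W h); auto.
  intros x; apply (covered_slices s _ (fun z => snd (f z)) y0 H h); auto.
  - intros z [Hz _]; auto.
  - intros y; refine (covered_mono s _ _ _ _ _ (Rle_refl _) (Ht x y)); tauto.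
Qed.

Lemma box_diam (u v : C) (x y h : R) :
  x <= fst u <= x + h -> y <= snd u <= y + h ->
  x <= fst v <= x + h -> y <= snd v <= y + h ->
  Cmod (Cminus u v) <= 2 * h.
Proof.
  intros H1 H2 H3 H4; apply Rle_trans with (1 := Cmod_le_abs _).
  assert (Rabs (fst (Cminus u v)) <= h) by (simpl; apply Rabs_le; lra).
  assert (Rabs (snd (Cminus u v)) <= h) by (simpl; apply Rabs_le; lra).
  lra.
Qed.

(** The indices run from 0 to [n - 1], unlike those of [prod_a]: these are the times that [n]
    successive pullbacks visit, the last being the initial point itself. *)
Fixpoint prod_lt (a : nat -> R) (n : nat) : R :=
  match n with O => 1 | S m => prod_lt a m * a m end.

Lemma prod_lt_pos (a : nat -> R) (n : nat) : (forall k, 0 < a k) -> 0 < prod_lt a n.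
Proof. intros H; induction n as [|n IH]; simpl; [lra|apply Rmult_lt_0_compat; auto]. Qed.

(* The bound [Cmod z <= m] makes the base case of [covered_preimage] possible: the
   weight [rho^(-s)] of an initial piece is at least [m^(-s)]. *)
Definition orbit_ge (lam : nat -> C) (a : nat -> R) (m : R) (n : nat) (z : C) : Prop :=
  Cmod z <= m /\ forall k, (k < n)%nat -> a k <= Cmod (Eiter lam k z).

(* Squares of side [c / 4] cut a preimage in [r <= |w| <= 2 r] into at most
   [(9 / c) * (17 r / c)] pieces, each of diameter at most [6 d / rho]. *)
Definition pull_const (s c : R) : R :=
  / (1 - Rpower 2 (1 - s)) * (153 / (c * c) * Rpower 6 s).

Lemma dyadic_const_pos (s : R) : 1 < s -> 0 < / (1 - Rpower 2 (1 - s)).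
Proof.
  intros Hs; apply Rinv_0_lt_compat.
  assert (Rpower 2 (1 - s) < Rpower 2 0) by (apply Rpower_lt; lra).
  rewrite Rpower_O in *; lra.
Qed.

Lemma pull_const_pos (s c : R) : 1 < s -> 0 < c -> 0 < pull_const s c.
Proof.
  intros Hs Hc; unfold pull_const.
  assert (H := dyadic_const_pos s Hs); assert (H6 := Rpower_pos 6 s).
  assert (0 < 153 / (c * c)) by (apply Rdiv_lt_0_compat; nra).
  apply Rmult_lt_0_compat; [easy|apply Rmult_lt_0_compat; easy].
Qed.

Lemma Rpower_div (x y s : R) :
  0 < x -> 0 < y -> Rpower (x / y) s = Rpower x s * Rpower y (- s).
Proof.
  intros Hx Hy; unfold Rdiv.
  rewrite <- Rpower_mult_distr by (try apply Rinv_0_lt_compat; easy).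
  f_equal; unfold Rpower; rewrite ln_Rinv by easy; f_equal; ring.
Qed.

Lemma Rpower_1_minus (x s : R) : 0 < x -> Rpower x (1 - s) = x * Rpower x (- s).
Proof.
  intros Hx; unfold Rminus; rewrite Rpower_plus, Rpower_1 by easy; reflexivity.
Qed.

(** Induction on the number of pullbacks, for all pieces at once. One pullback turns the weight
    [(d / rho)^s] into at most O(r) weights [(6 d / rho)^s r^(-s)] on each dyadic annulus, and
    summing over [r >= a n] produces the new factor [(a n)^(1 - s)]. *)
Lemma covered_preimage (lam : nat -> C) (a : nat -> R) (s c m : R) :
  1 < s -> 0 < c -> c <= 1 -> (forall k, c <= a k) ->
  forall (n : nat) (U : C -> Prop) (d rho : R),
  0 < d -> 2 * d <= rho ->
  (forall x, U x -> rho <= Cmod x) ->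
  (forall x y, U x -> U y -> Cmod (Cminus x y) <= d) ->
  covered s (fun z => orbit_ge lam a m n z /\ U (Eiter lam n z))
    (Rpower m s * pull_const s c ^ n * Rpower (prod_lt a n) (1 - s) * Rpower (d / rho) s).
Proof.
  intros Hs Hc Hc1 Ha n; induction n as [|n IH]; intros U d rho Hd Hdr HU1 HU2.
  - simpl.
    (* If [U] meets the disc of radius [m], then [rho <= m], hence [d <= m * (d / rho)]; otherwise
       there is nothing to cover. *)
    destruct (classic (exists z, Cmod z <= m /\ U z)) as [[z0 [Hz0 HUz0]]|Hno].
    + assert (Hm : rho <= m) by (specialize (HU1 z0 HUz0); lra).
      refine (covered_mono s _ U (Rpower d s) _ _ _ (covered_diam s U d _ Hd HU2));
        [tauto| |lra].
      rewrite Rmult_1_r; unfold Rpower at 3; rewrite ln_1, Rmult_0_r, exp_0, Rmult_1_r.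
      rewrite Rpower_mult_distr by (try apply Rdiv_lt_0_compat; lra).
      apply Rle_Rpower_l; [lra|split; [easy|]].
      replace (m * (d / rho)) with (m / rho * d) by (field; lra).
      assert (1 <= m / rho).
      { apply Rmult_le_reg_r with rho; [lra|].
        unfold Rdiv; rewrite Rmult_assoc, Rinv_l by lra; lra. }
      nra.
    + apply covered_empty.
      * intros z [[Hz _] HUz]; apply Hno; exists z; auto.
      * pose proof (Rpower_pos m s); pose proof (Rpower_pos (d / rho) s).
        pose proof (Rpower_pos 1 (1 - s)).
        repeat (apply Rmult_le_pos; [|lra]); lra.
  - set (A := fun z => orbit_ge lam a m (S n) z /\ U (Eiter lam (S n) z)).
    set (K := Rpower m s * pull_const s c ^ n * Rpower (prod_lt a n) (1 - s)).
    assert (HK : 0 <= K).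
    { pose proof (Rpower_pos m s); pose proof (Rpower_pos (prod_lt a n) (1 - s)).
      pose proof (pow_le _ n (Rlt_le _ _ (pull_const_pos s c Hs Hc))).
      unfold K; repeat (apply Rmult_le_pos; [|lra]); lra. }
    set (e := d / rho) in *.
    assert (He : 0 < e) by (apply Rdiv_lt_0_compat; lra).
    (* A reference point [z0] is needed: all real parts at time [n] lie within 1 of that of [z0],
       which confines them to an interval of length 2. *)
    destruct (classic (exists z, A z)) as [[z0 Hz0]|Hno].
    2:{ apply covered_empty; [intros z Hz; apply Hno; exists z; exact Hz|].
      pose proof (Rpower_pos m s); pose proof (Rpower_pos (prod_lt a (S n)) (1 - s)).
      pose proof (Rpower_pos e s).
      pose proof (pow_le _ (S n) (Rlt_le _ _ (pull_const_pos s c Hs Hc))).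
      repeat (apply Rmult_le_pos; [|lra]); lra. }
    assert (Hdist : forall z z', A z -> A z' ->
      Rabs (fst (Eiter lam n z) - fst (Eiter lam n z')) <= 1 /\
      (Rabs (snd (Eiter lam n z) - snd (Eiter lam n z')) <= 1 ->
        Cmod (Cminus (Eiter lam n z) (Eiter lam n z')) <= 6 * e)).
    { intros z z' [_ Hz] [_ Hz'].
      apply (E_lam_inverse_bound (lam (S n)) _ _ d rho); [lra|easy|now apply HU1|now apply HU2]. }
    assert (Han := Ha n).
    assert (HP : 0 < prod_lt a n) by (apply prod_lt_pos; intros k; specialize (Ha k); lra).
    refine (covered_mono s A A _ _ (fun z Hz => Hz) _
      (covered_dyadic s A (Eiter lam n) (a n) (153 / (c * c) * Rpower 6 s * (K * Rpower e s))
        Hs _ _ _)).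
    + right; simpl.
      rewrite <- Rpower_mult_distr by lra; unfold K; set (X := pull_const s c ^ n); unfold pull_const; ring.
    + lra.
    + intros z [[_ Hz] _]; apply Hz; lia.
    + intros r Hr.
      assert (Hh : 0 < c / 4) by lra.
      assert (Hr0 : 0 < r) by lra.
      assert (Hrc : 1 <= r / c).
      { apply Rmult_le_reg_r with c; [lra|].
        unfold Rdiv; rewrite Rmult_assoc, Rinv_l by lra; lra. }
      set (t := K * (Rpower (6 * e) s * Rpower r (- s))).
      assert (Ht : 0 <= t).
      { unfold t; pose proof (Rpower_pos (6 * e) s); pose proof (Rpower_pos r (- s)).
        apply Rmult_le_pos; [easy|apply Rmult_le_pos; lra]. }
      refine (covered_mono s _ _ _ _ (fun z Hz => Hz) _
        (covered_box s _ (Eiter lam n) (fst (Eiter lam n z0) - 1) 2 (- (2 * r)) (4 * r)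
          (c / 4) t Hh _ _ _ _ _)).
      * assert (H1 : 2 / (c / 4) + 1 <= 9 / c).
        { replace (2 / (c / 4)) with (8 * / c) by (field; lra).
          replace (9 / c) with (8 * / c + / c) by (field; lra).
          pose proof (Rinv_le_contravar c 1 Hc Hc1); lra. }
        assert (H2 : 4 * r / (c / 4) + 1 <= 17 * (r / c)).
        { replace (4 * r / (c / 4)) with (16 * (r / c)) by (field; lra); lra. }
        assert (H3 : 0 <= 2 / (c / 4) + 1).
        { replace (2 / (c / 4)) with (8 * / c) by (field; lra).
          pose proof (Rinv_0_lt_compat c Hc); lra. }
        apply Rle_trans with (9 / c * (17 * (r / c) * t)).
        -- assert (0 <= 4 * r / (c / 4) + 1).
           { replace (4 * r / (c / 4)) with (16 * (r / c)) by (field; lra); lra. }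
           apply Rmult_le_compat; [easy| |easy|].
           ++ apply Rmult_le_pos; easy.
           ++ apply Rmult_le_compat_r; easy.
        -- right; unfold t; rewrite Rpower_1_minus by easy.
           rewrite <- Rpower_mult_distr by lra; field; lra.
      * lra.
      * lra.
      * intros z [Hz _]; destruct (Hdist z z0 Hz Hz0) as [H _].
        apply Rabs_le_between in H; lra.
      * intros z [_ Hz]; assert (H := snd_le_Cmod (Eiter lam n z)).
        apply Rabs_le_between in H; lra.
      * intros x y.
        (* Points of [U'] are recorded as values of orbits from [A], so that the distortion bound
           applies. The side [c / 4] is at most 1, which keeps the imaginary parts close enough to
           select a single branch. *)
        set (U' := fun v : C => (exists z, A z /\ Eiter lam n z = v) /\ r <= Cmod v /\
          x <= fst v <= x + c / 4 /\ y <= snd v <= y + c / 4).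
        (* The bound [6 * e] carries the cost estimate; the bound [c / 2] ensures that twice the
           diameter is at most [c <= r], as the induction hypothesis demands. *)
        assert (Hd' : 0 < Rmin (c / 2) (6 * e)) by (apply Rmin_pos; lra).
        assert (Hl := Rmin_l (c / 2) (6 * e)); assert (Hr' := Rmin_r (c / 2) (6 * e)).
        refine (covered_mono s _ (fun z => orbit_ge lam a m n z /\ U' (Eiter lam n z))
          _ _ _ _ (IH U' (Rmin (c / 2) (6 * e)) r Hd' _ _ _)).
        -- intros z [[Hz Hzr] Hxy]; split.
           ++ destruct Hz as [[Hz1 Hz2] _]; split; [easy|intros k Hk; apply Hz2; lia].
           ++ split; [exists z; auto|tauto].
        -- fold K; unfold t; rewrite Rpower_div by easy.
           apply Rmult_le_compat_l; [easy|].
           apply Rmult_le_compat_r; [apply Rlt_le, Rpower_pos|].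
           apply Rle_Rpower_l; lra.
        -- lra.
        -- intros v Hv; apply Hv.
        -- intros u v ((z & Hz & <-) & _ & Hu1 & Hu2) ((z' & Hz' & <-) & _ & Hv1 & Hv2).
           apply Rmin_glb.
           ++ replace (c / 2) with (2 * (c / 4)) by field.
              apply (box_diam _ _ x y); easy.
           ++ apply (Hdist z z' Hz Hz'), Rabs_le; lra.
Qed.

(* With squares of side [h <= min D (r / 4)] the strip meets [r <= |w| <= 2 r] in at most
   [17 * (5 r / h)] of them, each of diameter at most [2 h]. *)
Definition strip_const (s : R) : R :=
  / (1 - Rpower 2 (1 - s)) * (85 * Rpower 2 s).

(** In each annulus the strip is cut into squares of side [h], which [covered_preimage] pulls back
    to time 0. Their O(r / h) costs of order [(h / r)^s] add up to order [(h / r)^(s - 1)], which is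
    summable over dyadic [r]. *)
Lemma covered_strip (lam : nat -> C) (a : nat -> R) (s c m x0 D : R) (n : nat) :
  1 < s -> 0 < c -> c <= 1 -> (forall k, c <= a k) -> 0 < D ->
  covered s (fun z => orbit_ge lam a m (S n) z /\ x0 <= fst (Eiter lam n z) <= x0 + D)
    (strip_const s * Rpower m s * pull_const s c ^ n *
      Rpower (prod_lt a (S n)) (1 - s) * Rpower D (s - 1)).
Proof.
  intros Hs Hc Hc1 Ha HD.
  set (A := fun z => orbit_ge lam a m (S n) z /\ x0 <= fst (Eiter lam n z) <= x0 + D).
  set (K := Rpower m s * pull_const s c ^ n * Rpower (prod_lt a n) (1 - s)).
  assert (HK : 0 <= K).
  { pose proof (Rpower_pos m s); pose proof (Rpower_pos (prod_lt a n) (1 - s)).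
    pose proof (pow_le _ n (Rlt_le _ _ (pull_const_pos s c Hs Hc))).
    unfold K; repeat (apply Rmult_le_pos; [|lra]); lra. }
  assert (HP : 0 < prod_lt a n) by (apply prod_lt_pos; intros k; specialize (Ha k); lra).
  assert (Han := Ha n).
  refine (covered_mono s A A _ _ (fun z Hz => Hz) _
    (covered_dyadic s A (Eiter lam n) (a n) (85 * Rpower 2 s * (K * Rpower D (s - 1)))
      Hs _ _ _)).
  - right; simpl.
    rewrite <- Rpower_mult_distr by lra; unfold strip_const, K; ring.
  - lra.
  - intros z [[_ Hz] _]; apply Hz; lia.
  - intros r Hr; assert (Hr0 : 0 < r) by lra.
    assert (Hsq : forall h, 0 < h -> 4 * h <= r -> forall x y,
      covered s (fun z => (A z /\ r <= Cmod (Eiter lam n z) <= 2 * r) /\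
        x <= fst (Eiter lam n z) <= x + h /\ y <= snd (Eiter lam n z) <= y + h)
        (K * Rpower (2 * h / r) s)).
    { intros h Hh Hhr x y.
      set (U := fun v : C => r <= Cmod v /\ x <= fst v <= x + h /\ y <= snd v <= y + h).
      refine (covered_mono s _ _ _ _ _ (Rle_refl _)
        (covered_preimage lam a s c m Hs Hc Hc1 Ha n U (2 * h) r _ _ _ _)); try lra.
      - intros z [[[[Hz1 Hz2] _] Hzr] Hxy]; split.
        + split; [easy|intros k Hk; apply Hz2; lia].
        + unfold U; tauto.
      - intros v Hv; apply Hv.
      - intros u v Hu Hv; apply (box_diam _ _ x y); first [apply Hu|apply Hv]. }
    (* A strip narrow compared with [r] takes [h = W = D], and a count of 2. A wide one takes
       [h = r / 4] and forgets the strip: the annulus has width [4 * r], which gives the count 17.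
       In both cases [4 * h <= r] allows pieces of diameter [2 * h] to be pulled back. *)
    assert (Hh : exists h W x1, 0 < h /\ h <= D /\ 4 * h <= r /\ 0 <= W /\ W / h + 1 <= 17 /\
      forall z, A z /\ r <= Cmod (Eiter lam n z) <= 2 * r ->
        x1 <= fst (Eiter lam n z) <= x1 + W).
    { destruct (Rle_dec (4 * D) r) as [H|H].
      - exists D, D, x0; repeat split; try lra.
        + replace (D / D) with 1 by (field; lra); lra.
        + apply H0.
        + apply H0.
      - exists (r / 4), (4 * r), (- (2 * r)); repeat split; try lra.
        + replace (4 * r / (r / 4)) with 16 by (field; lra); lra.
        + assert (H1 := fst_le_Cmod (Eiter lam n z)); apply Rabs_le_between in H1; lra.
        + assert (H1 := fst_le_Cmod (Eiter lam n z)); apply Rabs_le_between in H1; lra. }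
    destruct Hh as (h & W & x1 & Hh & HhD & Hhr & HW & HWh & HAW).
    set (t := K * Rpower (2 * h / r) s) in *.
    assert (Ht : 0 <= t) by
      (unfold t; pose proof (Rpower_pos (2 * h / r) s); apply Rmult_le_pos; lra).
    refine (covered_mono s _ _ _ _ (fun z Hz => Hz) _
      (covered_box s _ (Eiter lam n) x1 W (- (2 * r)) (4 * r) h t Hh HW _ HAW _
        (Hsq h Hh Hhr))).
    + assert (Hrh : 1 <= r / h).
      { apply Rmult_le_reg_r with h; [lra|].
        unfold Rdiv; rewrite Rmult_assoc, Rinv_l by lra; lra. }
      assert (H2 : 4 * r / h + 1 <= 5 * (r / h)).
      { replace (4 * r / h) with (4 * (r / h)) by (field; lra); lra. }
      assert (H3 : 0 <= 4 * r / h + 1).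
      { replace (4 * r / h) with (4 * (r / h)) by (field; lra); lra. }
      assert (H4 : 0 <= W / h) by (apply Rdiv_le_0_compat; lra).
      apply Rle_trans with (17 * (5 * (r / h) * t)).
      { apply Rmult_le_compat; [lra|apply Rmult_le_pos; lra|lra|].
        apply Rmult_le_compat_r; easy. }
      apply Rle_trans with (85 * Rpower 2 s * (K * Rpower h (s - 1)) * Rpower r (1 - s)).
      * right; unfold t; rewrite Rpower_div by lra.
        rewrite <- Rpower_mult_distr by lra.
        rewrite (Rpower_1_minus r) by lra.
        replace (Rpower h s) with (h * Rpower h (s - 1))
          by (rewrite <- (Rpower_1 h) at 1 by easy; rewrite <- Rpower_plus; f_equal; ring).
        field; lra.
      * pose proof (Rpower_pos 2 s); pose proof (Rpower_pos r (1 - s)).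
        apply Rmult_le_compat_r; [lra|].
        apply Rmult_le_compat_l; [lra|].
        apply Rmult_le_compat_l; [lra|].
        apply Rle_Rpower_l; lra.
    + lra.
    + intros z [_ Hz]; assert (H1 := snd_le_Cmod (Eiter lam n z)).
      apply Rabs_le_between in H1; lra.
Qed.

(** * Null sets and Hausdorff dimension *)

(** No bound on the diameters is imposed: a small total cost forces every piece to be small. *)
Definition null (s : R) (A : C -> Prop) : Prop :=
  forall eps, 0 < eps -> covered s A eps.

Lemma null_bigunion (s : R) (A : nat -> C -> Prop) :
  (forall j, null s (A j)) -> null s (fun z => exists j, A j z).
Proof.
  intros HA eps He.
  apply (covered_bigunion s A (fun j => eps / 2 * (/ 2) ^ j)).
  - intros j; apply HA; apply Rmult_lt_0_compat; [lra|]; apply pow_lt; lra.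
  - intros N; rewrite psum_scal.
    assert (H := psum_geom_le (/ 2) N ltac:(lra)).
    apply Rmult_le_compat_l with (r := eps / 2) in H; [|lra].
    replace (eps / 2 * / (1 - / 2)) with eps in H by field; exact H.
Qed.

Lemma Rpower_inv_exp (x s : R) : 0 < x -> s <> 0 -> Rpower (Rpower x (/ s)) s = x.
Proof. intros Hx Hs; rewrite Rpower_mult, Rinv_l, Rpower_1 by easy; reflexivity. Qed.

Lemma null_singleton (s : R) (w : C) : 0 < s -> null s (fun z => z = w).
Proof.
  intros Hs eps He; rewrite <- (Rpower_inv_exp eps s) by lra.
  apply covered_diam; [easy|apply Rpower_pos|].
  intros x y -> ->; replace (Cminus w w) with (RtoC 0) by ring.
  rewrite Cmod_0; apply Rlt_le, Rpower_pos.
Qed.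

Lemma null_union (s : R) (A B : C -> Prop) :
  null s A -> null s B -> null s (fun z => A z \/ B z).
Proof.
  intros HA HB eps He; replace eps with (eps / 2 + eps / 2) by field.
  apply covered_union; [apply HA|apply HB]; lra.
Qed.

Lemma le_Rpower_of_pw (s t x : R) : 0 < s -> 0 < t -> pw x s <= t -> x <= Rpower t (/ s).
Proof.
  intros Hs Ht Hx; destruct (Rle_dec x (Rpower t (/ s))) as [|Hn]; [easy|exfalso].
  assert (Hp := Rpower_pos t (/ s)).
  rewrite pw_pos in Hx by lra.
  assert (Rpower (Rpower t (/ s)) s < Rpower x s) by (apply Rlt_Rpower_l; lra).
  rewrite Rpower_inv_exp in *; lra.
Qed.

Lemma diam_le (U : C -> Prop) (d : R) :
  (forall x y, U x -> U y -> Cmod (Cminus x y) <= d) -> Rbar_le (diam U) d.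
Proof.
  intros H; apply (proj2 (Lub_Rbar_correct _)).
  intros r (x & y & Hx & Hy & ->); apply H; easy.
Qed.

Lemma cost_le (s t : R) (U : C -> Prop) :
  0 < s -> 0 <= t -> (forall x y, U x -> U y -> pw (Cmod (Cminus x y)) s <= t) ->
  cost s U <= t.
Proof.
  (* The slack [eps] avoids [t = 0], where [Rpower t (/ s)] would be 1 instead of 0. *)
  intros Hs Ht HU; apply le_epsilon; intros eps He.
  assert (Hd := diam_le U (Rpower (t + eps) (/ s))).
  unfold cost; destruct (diam U) as [d| |]; [|lra|lra].
  rewrite <- (Rpower_inv_exp (t + eps) s) by lra.
  apply pw_le_Rpower; [easy|apply Rpower_pos|apply Hd].
  intros x y Hx Hy; apply le_Rpower_of_pw; [easy|lra|].
  specialize (HU x y Hx Hy); lra.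
Qed.

Lemma Hs_delta_null (s delta : R) (A : C -> Prop) :
  0 < s -> 0 < delta -> null s A -> Hs_delta s delta A = Finite 0.
Proof.
  intros Hs Hdelta HA; apply Rbar_is_glb_unique; split.
  - intros v (U & _ & _ & ->).
    apply (proj1 (Lub_Rbar_correct _)); exists 0%nat; reflexivity.
  - intros v Hv.
    assert (Hle : forall eps, 0 < eps -> Rbar_le v eps).
    { intros eps He.
      (* Each weight is at most the total, hence at most [Rpower delta s], which makes every
         diameter at most [delta]. *)
      assert (Hmin : 0 < Rmin eps (Rpower delta s)) by (apply Rmin_pos; [easy|apply Rpower_pos]).
      assert (Hml := Rmin_l eps (Rpower delta s)); assert (Hmr := Rmin_r eps (Rpower delta s)).
      destruct (HA _ Hmin) as (U & t & Ht & HU & Hcov & Hsum).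
      apply Rbar_le_trans with (series_sum (fun i => cost s (U i))).
      - apply Hv; exists U; split; [|split; [exact Hcov|reflexivity]].
        intros i; apply diam_le; intros x y Hx Hy.
        assert (Hti := psum_ge_term t i Ht); specialize (Hsum (S i)).
        specialize (HU i x y Hx Hy).
        replace delta with (Rpower (Rpower delta s) (/ s)).
        2:{ rewrite Rpower_mult, Rinv_r, Rpower_1 by lra; reflexivity. }
        apply le_Rpower_of_pw; [easy|apply Rpower_pos|lra].
      - apply (proj2 (Lub_Rbar_correct _)); intros x [N ->]; simpl.
        apply Rle_trans with (psum t N); [|specialize (Hsum N); lra].
        apply psum_le; intros i; apply cost_le; auto. }
    destruct v as [r| |]; simpl.
    + apply le_epsilon; intros eps He; rewrite Rplus_0_l; apply (Hle eps He).
    + exact (Hle 1 Rlt_0_1).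
    + exact I.
Qed.

Lemma Hmeas_null (s : R) (A : C -> Prop) : 0 < s -> null s A -> Hmeas s A = Finite 0.
Proof.
  intros Hs HA; apply Rbar_is_lub_unique; split.
  - intros v (delta & Hd & ->); rewrite Hs_delta_null by easy; apply Rbar_le_refl.
  - intros v Hv; apply Hv; exists 1; split; [lra|].
    rewrite Hs_delta_null by (easy || lra); reflexivity.
Qed.

(** Every [s > 1] competes in the infimum defining [dimH]; then [s] tends to 1. *)
Lemma dimH_le_1 (A : C -> Prop) :
  (forall s, 1 < s -> null s A) -> Rbar_le (dimH A) (Finite 1).
Proof.
  intros HA.
  assert (Hle : forall s, 1 < s -> Rbar_le (dimH A) s).
  { intros s Hs.
    unfold dimH, Rbar_glb; match goal with |- context [Rbar_ex_glb ?E] =>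
      destruct (Rbar_ex_glb E) as [l Hl] end; simpl proj1_sig.
    apply (proj1 Hl); exists s; split; [lra|split; [reflexivity|]].
    apply Hmeas_null; [lra|now apply HA]. }
  destruct (dimH A) as [r| |]; simpl.
  - apply le_epsilon; intros eps He; apply (Hle (1 + eps)); lra.
  - exact (Hle 2 ltac:(lra)).
  - exact I.
Qed.

(** * Choice of the pullback time and exhaustion by tame orbits *)

Lemma prod_a_pos (a : nat -> R) (n : nat) :
  (forall k, (1 <= k)%nat -> 0 < a k) -> 0 < prod_a a n.
Proof.
  intros H; induction n as [|n IH]; simpl; [lra|apply Rmult_lt_0_compat; [easy|apply H; lia]].
Qed.

(** The two sequences agree from [N] on, so the ratio of the products is frozen at its value for
    [n = N]. *)
Lemma prod_lt_eq_prod_a (a a' : nat -> R) (N : nat) :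
  (forall k, (1 <= k)%nat -> 0 < a k) -> (forall k, 0 < a' k) ->
  (forall k, (N <= k)%nat -> a' k = a k) ->
  exists kappa, 0 < kappa /\
    forall n, (N <= n)%nat -> prod_lt a' (S n) = kappa * prod_a a n.
Proof.
  intros Ha Ha' HN.
  assert (HP := prod_a_pos a N Ha).
  exists (prod_lt a' (S N) / prod_a a N); split.
  - apply Rdiv_lt_0_compat; [now apply prod_lt_pos|easy].
  - intros n Hn; induction Hn as [|n Hn IH]; [field; lra|].
    change (prod_lt a' (S (S n))) with (prod_lt a' (S n) * a' (S n)).
    rewrite IH, HN by lia; simpl; ring.
Qed.

(* [a'] replaces finitely many of the [a k], including the meaningless [a 0], by a
   positive lower bound for the orbit. *)
Definition tame_orbit (lam : nat -> C) (a' b : nat -> R) (N : nat) (m : R) (z : C) : Prop :=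
  Cmod z <= m /\ (forall k, a' k <= Cmod (Eiter lam k z)) /\
  forall n, (N <= n)%nat -> Cmod (Eiter lam n z) <= b n.

(** For each tolerance a single late time [n] supplied by the liminf is used: the constraint at time
    [n + 1] yields a strip at time [n], and [covered_strip] bounds its cost. *)
Lemma null_tame_orbit (lam : nat -> C) (a a' b : nat -> R) (c m s : R) (N : nat) :
  1 < s -> 0 < c -> c <= 1 ->
  (forall n, (1 <= n)%nat -> lam n <> 0%C) ->
  (forall n, (1 <= n)%nat -> 0 < a n /\ a n < b n) ->
  (forall k, c <= a' k) -> (forall k, (N <= k)%nat -> a' k = a k) ->
  LimInf_seq (fun m : nat =>
     Rpower (Delta_n a b (S (S m)) / prod_a a (S m)) (/ INR (S m))) = Finite 0 ->
  null s (tame_orbit lam a' b N m).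
Proof.
  intros Hs Hc Hc1 Hlam Hab Ha' HN Hlim tol Htol.
  assert (Hapos : forall k, (1 <= k)%nat -> 0 < a k) by (intros k Hk; apply (Hab k Hk)).
  destruct (prod_lt_eq_prod_a a a' N Hapos) as [kappa [Hkappa Hprod]];
    [intros k; specialize (Ha' k); lra|easy|].
  set (K := pull_const s c).
  assert (HK : 0 < K) by now apply pull_const_pos.
  set (X := strip_const s * Rpower m s * Rpower kappa (1 - s)).
  assert (HX : 0 < X).
  { unfold X, strip_const.
    assert (H1 := dyadic_const_pos s Hs); pose proof (Rpower_pos 2 s).
    pose proof (Rpower_pos m s); pose proof (Rpower_pos kappa (1 - s)).
    repeat (apply Rmult_lt_0_compat; try lra). }
  destruct (pow_lt_1_zero (/ 2) ltac:(rewrite Rabs_pos_eq; lra) (tol / X)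
    ltac:(apply Rdiv_lt_0_compat; lra)) as [N1 HN1].
  assert (Hinf : is_LimInf_seq (fun m : nat =>
     Rpower (Delta_n a b (S (S m)) / prod_a a (S m)) (/ INR (S m))) (Finite 0)).
  { rewrite <- Hlim; unfold LimInf_seq; destruct (ex_LimInf_seq _) as [l Hl]; exact Hl. }
  (* Chosen so that [eps^(s - 1) = / (2 * K)]: its [n]-th power cancels [K ^ n] and leaves
     [(/ 2) ^ n], which is below [tol / X] once [n >= N1]. *)
  set (eps := Rpower (/ (2 * K)) (/ (s - 1))).
  (* The sequence is indexed from 0, so its term [j] concerns the time [n = S j]. *)
  destruct (proj1 (Hinf (mkposreal eps (Rpower_pos _ _))) (N + N1)%nat) as [j [Hj Hlt]].
  simpl pos in Hlt; rewrite Rplus_0_l in Hlt; clear Hinf Hlim.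
  set (n := S j) in *.
  assert (Hn : 0 < INR n) by (apply lt_0_INR; unfold n; lia).
  set (D := Delta_n a b (S n)) in *.
  destruct (Hab (S n) ltac:(lia)) as [Han Habn].
  assert (HDeq : D = ln (b (S n)) - ln (a (S n))) by (unfold D, Delta_n; apply ln_div; lra).
  assert (HD : 0 < D) by (rewrite HDeq; pose proof (ln_increasing _ _ Han Habn); lra).
  assert (HPi := prod_a_pos a n Hapos).
  assert (Hy : 0 < D / prod_a a n) by (apply Rdiv_lt_0_compat; lra).
  assert (Hsmall : Rpower (D / prod_a a n) (s - 1) <= (/ (2 * K)) ^ n).
  { assert (H2K : 0 < / (2 * K)) by (apply Rinv_0_lt_compat; lra).
    rewrite <- Rpower_pow by easy.
    replace (D / prod_a a n) with (Rpower (Rpower (D / prod_a a n) (/ INR n)) (INR n))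
      by (apply Rpower_inv_exp; lra).
    rewrite <- (Rpower_inv_exp (/ (2 * K)) (s - 1)) by lra.
    fold eps; set (y := Rpower (D / prod_a a n) (/ INR n)) in *.
    rewrite (Rpower_mult y), (Rpower_mult eps), (Rmult_comm (s - 1)).
    apply Rle_Rpower_l; [|split; [apply Rpower_pos|lra]].
    apply Rmult_le_pos; lra. }
  assert (Hlam0 : 0 < Cmod (lam (S n))) by (apply Cmod_gt_0, Hlam; lia).
  (* Taking logarithms of [Cmod (lam (S n)) * exp (fst (Eiter lam n z))] between [a (S n)] and
     [b (S n)] gives this left end and the width [D]. *)
  refine (covered_mono s _ _ _ _ _ _ (covered_strip lam a' s c m
    (ln (a (S n)) - ln (Cmod (lam (S n)))) D n Hs Hc Hc1 Ha' HD)).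
  - intros z (Hz & Hlow & Hup); split; [split; [easy|intros k _; apply Hlow]|].
    specialize (Hlow (S n)); specialize (Hup (S n) ltac:(lia)).
    rewrite HN in Hlow by lia.
    change (Eiter lam (S n) z) with (E_lam (lam (S n)) (Eiter lam n z)) in Hlow, Hup.
    rewrite Cmod_E_lam in Hlow, Hup.
    assert (He := exp_pos (fst (Eiter lam n z))).
    assert (H1 := ln_le _ _ Han Hlow).
    assert (H2 := ln_le _ _ (Rmult_lt_0_compat _ _ Hlam0 He) Hup).
    rewrite ln_mult, ln_exp in H1, H2 by easy; lra.
  - rewrite Hprod by lia; fold K.
    apply Rle_trans with (X * (K ^ n * Rpower (D / prod_a a n) (s - 1))).
    + right; unfold X; rewrite <- Rpower_mult_distr, Rpower_div by easy.
      replace (- (s - 1)) with (1 - s) by ring; ring.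
    + apply Rle_trans with (X * (/ 2) ^ n).
      * apply Rmult_le_compat_l; [lra|].
        replace ((/ 2) ^ n) with (K ^ n * (/ (2 * K)) ^ n).
        -- apply Rmult_le_compat_l; [apply pow_le; lra|easy].
        -- rewrite <- Rpow_mult_distr; f_equal; field; lra.
      * specialize (HN1 n ltac:(unfold n; lia)).
        rewrite Rabs_pos_eq in HN1 by (apply pow_le; lra).
        replace tol with (X * (tol / X)) by (field; lra).
        apply Rmult_le_compat_l; lra.
Qed.

(** Early orbit points have positive but uncontrolled moduli; bounds [/ INR (S m)] suffice for
    finitely many of them and form a countable family. *)
Lemma exists_inv_lower_bound (f : nat -> R) (N : nat) :
  (forall k, 0 < f k) -> exists m0, forall m k, (m0 <= m)%nat -> (k < N)%nat ->
    / INR (S m) <= f k.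
Proof.
  intros Hf; induction N as [|N [m1 IH]]; [exists 0%nat; intros; lia|].
  destruct (nfloor_ex (/ f N)) as [m2 [_ Hm2]].
  { apply Rlt_le, Rinv_0_lt_compat, Hf. }
  exists (m1 + m2)%nat; intros m k Hm Hk.
  destruct (Nat.eq_dec k N) as [->|Hne]; [|apply IH; lia].
  rewrite <- (Rinv_inv (f N)).
  apply Rinv_le_contravar; [apply Rinv_0_lt_compat, Hf|].
  rewrite S_INR; assert (INR m2 <= INR m) by (apply le_INR; lia); lra.
Qed.

Theorem theorem2p1 (lam : nat -> C) (a b : nat -> R) :
  (forall n : nat, (1 <= n)%nat -> lam n <> 0%C) ->
  (forall n : nat, (1 <= n)%nat -> 0 < a n /\ a n < b n) ->
  (exists c : R, 0 < c /\ forall n : nat, (1 <= n)%nat -> c <= a n) ->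
  LimInf_seq (fun m : nat =>
     Rpower (Delta_n a b (S (S m)) / prod_a a (S m)) (/ INR (S m))) = Finite 0 ->
  Rbar_le (dimH (I_set lam a b)) (Finite 1).
Proof.
  intros Hlam Hab (c & Hc & Hca) Hlim.
  apply dimH_le_1; intros s Hs.
  set (a' := fun (N m k : nat) => if le_dec (S N) k then a k else / INR (S m)).
  (* The point 0 is split off because time 0 also needs a positive lower bound. The other orbits are
     sorted by two natural numbers, so countable unions suffice. *)
  assert (Hnull : null s (fun z => z = 0%C \/
    exists N m, tame_orbit lam (a' N m) b (S N) (INR (S m)) z)).
  { apply null_union; [apply null_singleton; lra|].
    apply null_bigunion; intros N; apply null_bigunion; intros m.
    assert (Hm : 0 < / INR (S m)) by (apply Rinv_0_lt_compat, lt_0_INR; lia).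
    assert (H0 := Rmin_l 1 (Rmin c (/ INR (S m)))).
    assert (H1 := Rmin_r 1 (Rmin c (/ INR (S m)))).
    assert (H2 := Rmin_l c (/ INR (S m))); assert (H3 := Rmin_r c (/ INR (S m))).
    apply (null_tame_orbit lam a _ b (Rmin 1 (Rmin c (/ INR (S m))))); auto.
    - repeat apply Rmin_pos; lra.
    - intros k; unfold a'; destruct (le_dec (S N) k); [|lra].
      specialize (Hca k ltac:(lia)); lra.
    - intros k Hk; unfold a'; destruct (le_dec (S N) k); [reflexivity|contradiction]. }
  intros eps He; refine (covered_mono s _ _ _ _ _ (Rle_refl _) (Hnull eps He)).
  intros z [N HN].
  destruct (classic (z = 0%C)) as [Hz|Hz]; [left; exact Hz|right].
  assert (Hpos : forall k, 0 < Cmod (Eiter lam k z)).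
  { intros [|k]; [now apply Cmod_gt_0|].
    simpl; rewrite Cmod_E_lam; apply Rmult_lt_0_compat; [|apply exp_pos].
    apply Cmod_gt_0, Hlam; lia. }
  destruct (exists_inv_lower_bound _ (S N) Hpos) as [m1 Hm1].
  destruct (nfloor_ex (Cmod z) (Cmod_ge_0 z)) as [m2 [_ Hm2]].
  (* [m1] puts [/ INR (S m)] below the moduli at times 0 to [N], and [m2] makes [INR (S m)] exceed
     [Cmod z]. *)
  exists N, (m1 + m2)%nat; split; [|split].
  - rewrite S_INR; assert (INR m2 <= INR (m1 + m2)) by (apply le_INR; lia); lra.
  - intros k; unfold a'; destruct (le_dec (S N) k).
    + apply HN; lia.
    + apply Hm1; lia.
  - intros n Hn; apply HN; lia.
Qed.
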